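(* Let $\Gamma$ be a distance-regular graph with classical parameters $(D,b,\alpha,\beta)$ such that $b\ge 2$ and $D\ge 3$, which is geometric with respect to a set $\mathcal C$ of Delsarte cliques (the members of $\mathcal C$ are called lines). Let $r=[D]$. If $\beta > (r-\alpha-1)\alpha b + \alpha$, then for every vertex $x$ and line $\ell$ with $d(x,\ell)=1$ and every two vertices $y_1,y_2$ on $\ell$ with $d(x,y_1)=d(x,y_2)=2$, we have $[x,y_1]=[x,y_2]$.
   Context: Distance-regular graph with intersection numbers $b_i,c_i$, valency $k=b_0$. For integer $b\ne1$, $[j]=\frac{b^j-1}{b-1}$. Classical parameters $(D,b,\alpha,\beta)$: diameter $D$, $b_i=([D]-[i])(\beta-\alpha[i])$ ($0\le i\le D-1$), $c_i=[i](1+\alpha[i-1])$ ($1\le i\le D$). A Delsarte clique is a clique with $1+\frac{k}{-\theta_{\min}}$ vertices, $\theta_{\min}$ the smallest adjacency eigenvalue. $\Gamma$ is geometric with respect to a set $\mathcal C$ of Delsarte cliques if every edge lies in exactly one member of $\mathcal C$. $d(x,\ell)=\min\{d(x,y): y\in\ell\}$. For vertices $x,y$ at distance 2, $[x,y]$ is the set of lines $\ell\in\mathcal C$ through $x$ such that $d(y,u)\le 2$ for all $u\in\ell$. *)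

(* Defs.v *)
From HB Require Import structures.
From mathcomp Require Import all_boot all_order all_algebra.
Set Implicit Arguments. Unset Strict Implicit. Unset Printing Implicit Defensive.
Import Order.TTheory GRing.Theory Num.Theory.

(* A simple graph is a symmetric irreflexive relation [adj] on a finite type. *)

Section Graph.
Variables (T : finType) (adj : rel T).

Definition walk_len (x y : T) (n : nat) : bool :=
  [exists p : n.-tuple T, path adj x p && (last x p == y)].

(* graph distance (= #|T| if y is unreachable from x) *)
Definition dist (x y : T) : nat := find (walk_len x y) (iota 0 #|T|).

Definition dist_set (x : T) (L : {set T}) : nat :=
  \big[minn/#|T|]_(y in L) dist x y.

Definition is_clique (C : {set T}) : Prop :=
  forall u v, u \in C -> v \in C -> u != v -> adj u v.

Definition adj_matrix (R : nzRingType) : 'M[R]_#|T| :=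
  \matrix_(i, j) ((adj (enum_val i) (enum_val j))%:R)%R.

Definition smallest_eigenvalue (R : rcfType) (theta : R) : Prop :=
  eigenvalue (adj_matrix R) theta /\
  forall mu : R, eigenvalue (adj_matrix R) mu -> (theta <= mu)%R.

(* Delsarte clique in a graph of valency k *)
Definition delsarte_clique (R : rcfType) (k : R) (C : {set T}) : Prop :=
  is_clique C /\
  exists theta : R, smallest_eigenvalue theta /\
    (#|C|%:R = 1 + k / (- theta))%R.

Definition geometric (R : rcfType) (k : R) (Cs : {set {set T}}) : Prop :=
  (forall L, L \in Cs -> delsarte_clique k L) /\
  (forall x y, adj x y -> #|[set L in Cs | (x \in L) && (y \in L)]| = 1%N).

Definition bracket (Cs : {set {set T}}) (x y : T) : {set {set T}} :=
  [set L in Cs | (x \in L) && [forall u in L, dist y u <= 2]].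

End Graph.

Definition gauss (R : fieldType) (b : int) (j : nat) : R :=
  (((b%:~R : R) ^+ j - 1) / (b%:~R - 1))%R.

Definition b_class (R : fieldType) (D : nat) (b : int) (alpha beta : R) (i : nat) : R :=
  ((gauss R b D - gauss R b i) * (beta - alpha * gauss R b i))%R.

Definition c_class (R : fieldType) (b : int) (alpha : R) (i : nat) : R :=
  (gauss R b i * (1 + alpha * gauss R b i.-1))%R.

Definition classical_DRG (T : finType) (adj : rel T) (R : fieldType)
    (D : nat) (b : int) (alpha beta : R) : Prop :=
  b != 1 /\
  (forall x y, (dist adj x y <= D)%N) /\
  (exists x y, dist adj x y = D) /\
  (forall x y (i : nat), dist adj x y = i ->
     ((i < D)%N ->
        (#|[set z | adj y z & dist adj x z == i.+1]|%:R = b_class D b alpha beta i)%R) /\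
     ((1 <= i)%N ->
        (#|[set z | adj y z & dist adj x z == i.-1]|%:R = c_class b alpha i)%R)).

(* Main.v *)
(** Let [[j]] be the Gaussian number [gauss R b j].  The standard sequence
  [w_0 = 1], [w_{i+1} = - w_i (1 + alpha [i]) / (beta - alpha [i])] gives, for each vertex [x],
  the eigenvector [y |-> w_{d(x,y)}] for [-[D]]; since [w] alternates in sign, a Sturm
  argument shows that no eigenvalue is smaller.  Hence lines have [1 + beta] points, every
  vertex is on [[D]] lines, and eigenvectors for [-[D]] sum to zero on each line, so that a
  vertex at distance [i < D] from a line has exactly [1 + alpha [i]] nearest points on it.
  Consequently, for [d(x,y) = 2], [[x,y]] consists of the [1 + b] lines on [x] that contain a
  neighbour of [y].

  Fix [x] and a line [L] at distance 1.  A line on [x] meeting [L] lies in every bracket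
  [[x,y]].  A line [M] on [x] missing [L] and lying outside one bracket [[x,y2]] lies in at most
  [alpha b] brackets: [L] and [M] have equally many points with a neighbour on the other line,
  and those on [M] are at distance 2 from [y2], hence number at most [1 + alpha [2]].  If the
  brackets were not all equal, each of the [beta - alpha] points [y] of [L] at distance 2 would
  have such an [M] in its bracket; as at most [[D] - 1 - alpha] lines on [x] miss [L], this
  would give [beta - alpha <= ([D] - 1 - alpha) alpha b]. *)

Require Import Defs.
From HB Require Import structures.
From mathcomp Require Import all_boot all_order all_algebra.
From mathcomp Require Import ring lra zify.
Import Order.TTheory GRing.Theory Num.Theory.
Set Implicit Arguments.
Unset Strict Implicit.
Unset Printing Implicit Defensive.

(** * Graph distance in a connected graph *)

Section Distance.
Variables (T : finType) (adj : rel T).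
Hypotheses (adj_sym : symmetric adj) (adj_conn : forall x y, connect adj x y).

Local Notation d := (dist adj).

Lemma walk_lenP x y n :
  reflect (exists2 p, path adj x p & last x p = y /\ size p = n)
          (walk_len adj x y n).
Proof.
apply: (iffP existsP) => [[p /andP[xp /eqP py]]|[p xp [py /eqP pn]]].
  by exists p; rewrite ?size_tuple.
by exists (Tuple pn); rewrite /= xp py eqxx.
Qed.

Lemma dist_le_size x p : path adj x p -> d x (last x p) <= size p.
Proof.
move=> xp; rewrite /dist.
have [sT|Ts] := ltnP (size p) #|T|; last first.
  by apply: leq_trans (find_size _ _) _; rewrite size_iota.
rewrite leqNgt; apply/negP => /(before_find 0).
rewrite nth_iota // add0n => /walk_lenP; apply.
by exists p.
Qed.

(** A walk shortened to distinct vertices has fewer than [#|T|] steps, so [find] succeeds and [dist]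
    never takes its default value. *)
Lemma dist_lt_card x y : d x y < #|T|.
Proof.
have [p xp yE] := connectP (adj_conn x y).
rewrite /dist -[X in _ < X](size_iota 0 #|T|) -has_find.
case/shortenP: xp yE => q xq uq _ yE.
apply/hasP; exists (size q); last by apply/walk_lenP; exists q.
rewrite mem_iota add0n /=.
by rewrite -[(size q).+1]/(size (x :: q)) -(card_uniqP uq) max_card.
Qed.

Lemma dist_path x y :
  exists2 p, path adj x p & last x p = y /\ size p = d x y.
Proof.
apply/walk_lenP; have lt := dist_lt_card x y.
have := lt; rewrite /dist -[X in _ < X](size_iota 0 #|T|) -has_find => /(nth_find 0).
by rewrite nth_iota.
Qed.

Lemma distxx x : d x x = 0.
Proof. by apply/eqP; rewrite -leqn0; apply: (@dist_le_size x [::]). Qed.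

Lemma dist_eq0 x y : (d x y == 0) = (x == y).
Proof.
apply/eqP/eqP => [d0|->]; last exact: distxx.
by have [p _ []] := dist_path x y; rewrite d0 => <- /size0nil ->.
Qed.

Lemma dist_sym x y : d x y = d y x.
Proof.
suff le u v : d u v <= d v u by apply/eqP; rewrite eqn_leq !le.
have [p vp [pu <-]] := dist_path v u.
have := @dist_le_size u (rev (belast v p)).
rewrite -pu rev_path size_rev size_belast.
have -> : last (last v p) (rev (belast v p)) = v.
  by case: p {vp pu} => //= a p; rewrite rev_cons last_rcons.
by apply; rewrite (eq_path (e' := adj)) // => a b; rewrite adj_sym.
Qed.

Lemma dist_adj x y z : adj y z -> d x z <= (d x y).+1.
Proof.
move=> yz; have [p xp [py <-]] := dist_path x y.
by rewrite -(size_rcons p z) -[z in X in X <= _](last_rcons x p) dist_le_size ?rcons_path ?py ?xp.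
Qed.

Lemma dist_pred x y n : d x y = n.+1 -> exists2 z, adj y z & d x z = n.
Proof.
move=> dxy; have [p xp [py]] := dist_path x y.
case/lastP: p xp py => [|p a]; first by rewrite dxy.
rewrite rcons_path last_rcons size_rcons dxy => /andP[xp pa] ay [sp].
exists (last x p); first by rewrite -ay adj_sym.
apply/eqP; rewrite eqn_leq -{1}sp dist_le_size //=.
by rewrite -ltnS -dxy -ay; apply: dist_adj.
Qed.

Lemma dist_le1 x y : (d x y <= 1) = (x == y) || adj x y.
Proof.
apply/idP/orP => [|[/eqP<-|xy]]; last 2 first.
- by rewrite distxx.
- by rewrite -(distxx x); apply: dist_adj.
rewrite leq_eqVlt ltnS leqn0 dist_eq0 => /orP[/eqP d1|->]; last by left.
have [z yz /eqP] := dist_pred d1.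
by rewrite dist_eq0 => /eqP->; right; rewrite adj_sym.
Qed.

Lemma dist_eq1 x y : irreflexive adj -> (d x y == 1) = adj x y.
Proof.
move=> irr; rewrite eqn_leq dist_le1 lt0n dist_eq0.
by case: eqVneq => [->|]; rewrite ?irr ?andbT.
Qed.

Lemma dist_set_le x z (L : {set T}) : z \in L -> dist_set adj x L <= d x z.
Proof.
move=> zL; rewrite /dist_set; elim: (index_enum T) (mem_index_enum z) => // u r IH.
rewrite inE big_cons => /orP[/eqP<-|/IH le]; first by rewrite zL geq_minl.
by case: ifP => // _; apply: leq_trans (geq_minr _ _) le.
Qed.

(** Distances stay below [#|T|], so the neutral element of the minimum is never its value over a
    nonempty [L]. *)
Lemma dist_set_attained x y (L : {set T}) :
  y \in L -> exists2 z, z \in L & d x z = dist_set adj x L.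
Proof.
move=> yL; have := leq_ltn_trans (dist_set_le x yL) (dist_lt_card x y).
rewrite /dist_set; set m := (X in X < _).
suff [->|] : m = #|T| \/ exists2 z, z \in L & d x z = m by rewrite ?ltnn.
rewrite /m; apply: (big_ind (fun m => m = #|T| \/ exists2 z, z \in L & d x z = m)).
- by left.
- by move=> a c Ha Hc; rewrite /minn; case: ifP.
- by move=> z zL; right; exists z.
Qed.

End Distance.

(** * Gaussian numbers for an integer base at least 2 *)

Section Gauss.
Local Open Scope ring_scope.
Variables (R : rcfType) (b : int).
Hypothesis hb : 2 <= b.
Local Notation G := (gauss R b).

Lemma intr_ge2 : 2 <= b%:~R :> R.
Proof. by rewrite -[2 in X in X <= _](@mulrz_nat R 2) ler_int. Qed.

Lemma gauss0 : G 0 = 0.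
Proof. by rewrite /gauss expr0 subrr mul0r. Qed.

Lemma gaussS i : G i.+1 = b%:~R * G i + 1.
Proof. by have b2 := intr_ge2; rewrite /gauss exprS; field; lra. Qed.

Lemma gauss1 : G 1 = 1.
Proof. by rewrite gaussS gauss0 mulr0 add0r. Qed.

Lemma gauss2 : G 2 = b%:~R + 1.
Proof. by rewrite gaussS gauss1 mulr1. Qed.

Lemma gauss_ge0 i : 0 <= G i.
Proof.
have b2 := intr_ge2; elim: i => [|i IH]; first by rewrite gauss0.
by rewrite gaussS addr_ge0 // mulr_ge0 //; lra.
Qed.

Lemma gauss_gt0 i : 0 < G i.+1.
Proof. by have b2 := intr_ge2; have := gauss_ge0 i; rewrite gaussS; nra. Qed.

Lemma gauss_lt i j : (i < j)%N -> G i < G j.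
Proof.
have b2 := intr_ge2; apply: (homo_ltn lt_trans) => k.
by have := gauss_ge0 k; rewrite gaussS; nra.
Qed.
End Gauss.

(** * Eigenvectors as functions on vertices *)

Section Adjacency.
Local Open Scope ring_scope.

(** Row vectors are read as functions through [enum_rank]; symmetry turns right multiplication by
    the adjacency matrix into neighbour sums. *)
Lemma eigenvalue_adjP (T : finType) (adj : rel T) (R : rcfType) (theta : R) :
  symmetric adj ->
  eigenvalue (adj_matrix adj R) theta <->
  exists2 f : T -> R, exists x, f x != 0 &
    forall y, \sum_(z | adj y z) f z = theta * f y.
Proof.
move=> adj_sym.
have mulE (v : 'rV[R]_#|T|) j : (v *m adj_matrix adj R) 0 j =
    \sum_(z | adj (enum_val j) z) v 0 (enum_rank z).
  rewrite mxE (reindex (@enum_rank T)) /=; last exact/onW_bij/enum_rank_bij.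
  rewrite [RHS]big_mkcond; apply: eq_bigr => z _.
  by rewrite mxE enum_rankK adj_sym; case: ifP; rewrite ?mulr1 ?mulr0.
split=> [/eigenvalueP[v vE v0]|[f [x fx] fE]].
  exists (fun z => v 0 (enum_rank z)).
    have /rV0Pn[j vj] := v0.
    by exists (enum_val j); rewrite enum_valK.
  by move=> y; rewrite -[y in adj y](enum_rankK y) -mulE vE mxE.
apply/eigenvalueP; exists (\row_j f (enum_val j)); last first.
  by apply/rV0Pn; exists (enum_rank x); rewrite mxE enum_rankK.
apply/rowP => j; rewrite mulE !mxE -fE.
by apply: eq_bigr => z _; rewrite mxE enum_rankK.
Qed.

End Adjacency.

(** * Intersection numbers and their signs *)

Section Drg.
Local Open Scope ring_scope.
Variables (T : finType) (adj : rel T) (R : rcfType).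
Variables (D : nat) (b : int) (alpha beta : R).
Hypotheses (adj_sym : symmetric adj) (adj_irr : irreflexive adj).
Hypothesis adj_conn : forall x y, connect adj x y.
Hypothesis hclass : classical_DRG adj D b alpha beta.
Hypotheses (hb : 2 <= b) (D_gt0 : (0 < D)%N).

Local Notation d := (dist adj).
Local Notation G := (gauss R b).
Local Notation B := (b_class D b alpha beta).
Local Notation C := (c_class b alpha).

Lemma dist_leD x y : (d x y <= D)%N.
Proof. by case: hclass => _ []. Qed.

(** Distance [D] is covered too: [B D] has the factor [D] - [D], and no vertex lies at distance
    [D.+1]. *)
Lemma sum_succ x y :
  \sum_(z | adj y z) (d x z == (d x y).+1)%:R = B (d x y) :> R.
Proof.
case: hclass => _ [_ [_ /(_ x y _ erefl)[+ _]]].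
have := dist_leD x y; rewrite leq_eqVlt => /orP[/eqP dD _|-> /(_ isT) <-].
  rewrite dD /b_class subrr mul0r big1 // => z _.
  by have := dist_leD x z; case: eqP => // ->; rewrite ltnn.
rewrite -sum1dep_card natr_sum big_mkcondr.
by apply: eq_bigr => z _; case: eqP.
Qed.

Lemma sum_pred x y :
  \sum_(z | adj y z) ((d x z).+1 == d x y)%:R = C (d x y) :> R.
Proof.
case: hclass => _ [_ [_ /(_ x y _ erefl)[_]]].
case: (d x y) => [_|i /(_ isT) <-].
  by rewrite /c_class gauss0 mul0r big1.
rewrite -sum1dep_card natr_sum big_mkcondr.
by apply: eq_bigr => z _; rewrite eqSS; case: eqP.
Qed.

Lemma degreeE y : \sum_(z | adj y z) 1 = B 0 :> R.
Proof.
rewrite -(distxx adj y) -sum_succ; apply: eq_bigr => z yz.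
by rewrite distxx dist_eq1 // yz.
Qed.

(** Neighbours of [y] are at distance i-1, i or i+1 from [x]; taking differences with [phi i] avoids
    counting those at distance i. At i = 0 the truncated predecessor gives a zero difference. *)
Lemma nbr_sum (phi : nat -> R) x y (i := d x y) :
  \sum_(z | adj y z) phi (d x z) =
  B 0 * phi i + C i * (phi i.-1 - phi i) + B i * (phi i.+1 - phi i).
Proof.
rewrite -(degreeE y) -sum_pred -sum_succ -/i !mulr_suml -!big_split /=.
apply: eq_bigr => z yz.
have le1 : (d x z <= i.+1)%N by apply: dist_adj.
have le2 : (i <= (d x z).+1)%N by apply: dist_adj; rewrite // adj_sym.
have [e|ne1] := eqVneq (d x z) i.+1.
  by rewrite e; case: eqP => [|_] /=; [lia | ring].
have [<- /=|ne2] := eqVneq (d x z).+1 i; first by ring.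
suff -> : d x z = i by rewrite /=; ring.
by apply/eqP; rewrite eqn_leq; lia.
Qed.

Lemma ex_dist i : (i <= D)%N -> exists x y, d x y = i.
Proof.
case: hclass => _ [_ [[x [y dD]] _]] /subKn <-.
elim: (D - i)%N => [|n [u [v duv]]]; first by exists x, y; rewrite dD subn0.
case e: (D - n)%N duv => [|m] duv; first by exists u, v; rewrite duv; lia.
have [z _ dz] := dist_pred adj_sym adj_conn duv.
by exists u, z; rewrite dz; lia.
Qed.

(** The last edge of a geodesic of length [i.+1] is counted by both numbers. The signs of
    [1 + alpha * G i] and [beta - alpha * G i] follow. *)
Lemma bc_gt0 i : (i < D)%N -> 0 < B i /\ 0 < C i.+1.
Proof.
move=> /ex_dist[x [y dxy]]; have [z yz dz] := dist_pred adj_sym adj_conn dxy.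
rewrite -{1}dz -dxy -sum_succ -sum_pred.
split; last by rewrite (bigD1 z) //= dxy dz eqxx ltr_wpDr // sumr_ge0.
by rewrite (bigD1 y) ?(adj_sym z) //= dxy dz eqxx ltr_wpDr // sumr_ge0.
Qed.

Lemma alpha_gt i : (i < D)%N -> 0 < 1 + alpha * G i.
Proof. by move=> /bc_gt0[_]; rewrite /c_class pmulr_rgt0 // gauss_gt0. Qed.

Lemma beta_gt i : (i < D)%N -> 0 < beta - alpha * G i.
Proof.
by move=> lt; have [+ _] := bc_gt0 lt; rewrite /b_class pmulr_rgt0 // subr_gt0 gauss_lt.
Qed.

Lemma beta_gt0 : 0 < beta.
Proof. by have := beta_gt D_gt0; rewrite gauss0 mulr0 subr0. Qed.

(** * The standard sequence and the smallest eigenvalue *)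

Fixpoint cosine (i : nat) : R :=
  if i is j.+1 then - cosine j * (1 + alpha * G j) / (beta - alpha * G j) else 1.

Lemma cosineS i : (i < D)%N ->
  cosine i.+1 * (beta - alpha * G i) = - cosine i * (1 + alpha * G i).
Proof. by move=> /beta_gt /gt_eqF/negbT b0 /=; rewrite divfK. Qed.

Lemma cosine_neq0 i : (i <= D)%N -> cosine i != 0.
Proof.
elim: i => [|i IH] iD; first exact: oner_neq0.
by rewrite /= !mulf_neq0 ?invr_neq0 ?oppr_eq0 ?IH ?(ltnW iD) // gt_eqF // (alpha_gt, beta_gt).
Qed.

(** The defining ratio makes the terms in [cosine i.-1] and [cosine i.+1] multiples of [cosine i];
    the coefficients then add up to [D] beta - [D] (1 + beta) = -[D]. *)
Lemma cosine_rec i : (i <= D)%N ->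
  B 0 * cosine i + C i * (cosine i.-1 - cosine i) + B i * (cosine i.+1 - cosine i)
  = - G D * cosine i.
Proof.
move=> iD.
have Bw : B i * cosine i.+1 = - (G D - G i) * (1 + alpha * G i) * cosine i.
  (* At [i = D] the zero [B D] removes [cosine D.+1], whose denominator is not known to be
     nonzero. *)
  move: iD; rewrite leq_eqVlt => /orP[/eqP->|/cosineS e].
    by rewrite /b_class subrr !mul0r oppr0 !mul0r.
  by rewrite /b_class -mulrA [_ * cosine _.+1]mulrC e; ring.
have Cw : C i * cosine i.-1 = - G i * (beta - alpha * G i.-1) * cosine i.
  case: i iD {Bw} => [|i] iD; first by rewrite /c_class gauss0; ring.
  rewrite /c_class [i.+1.-1]/=.
  transitivity (- G i.+1 * (- cosine i * (1 + alpha * G i))); first by ring.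
  by rewrite -cosineS //; ring.
rewrite !mulrBr Bw Cw /b_class /c_class gauss0.
ring.
Qed.

Lemma cosine_eigen x y :
  \sum_(z | adj y z) cosine (d x z) = - G D * cosine (d x y).
Proof. by rewrite nbr_sum cosine_rec // dist_leD. Qed.

Lemma eigenvalue_gaussN : eigenvalue (adj_matrix adj R) (- G D).
Proof.
apply/eigenvalue_adjP => //; have [x _] := ex_dist (leq0n D).
exists (fun y => cosine (d x y)); last exact: cosine_eigen.
by exists x; rewrite distxx oner_eq0.
Qed.

(* Pair [f] with the standard sequence truncated after [m]. *)
Lemma christoffel_darboux theta (f : T -> R) x m : (m <= D)%N ->
  (forall y, \sum_(z | adj y z) f z = theta * f y) ->
  (theta + G D) * \sum_(y | (d x y <= m)%N) cosine (d x y) * f y =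
  C m.+1 * cosine m * (\sum_(y | d x y == m.+1) f y)
  - B m * cosine m.+1 * (\sum_(y | d x y == m) f y).
Proof.
move=> mD fE; pose phi i := if (i <= m)%N then cosine i else 0.
(* The truncated sequence obeys the recurrence except at the cut, where the indices m and m+1
   produce the two boundary terms. *)
have phiE i : (i <= D)%N ->
    B 0 * phi i + C i * (phi i.-1 - phi i) + B i * (phi i.+1 - phi i) =
    - G D * phi i + (i == m.+1)%:R * (C m.+1 * cosine m)
    - (i == m)%:R * (B m * cosine m.+1).
  move=> iD; rewrite /phi; case: (ltngtP i m) => [im|mi|->].
  - by rewrite (leq_trans (leq_pred i) (ltnW im)) cosine_rec // ltn_eqF ?ltnS 1?ltnW // /=; ring.
  - have [->|ne] := eqVneq i m.+1; first by rewrite leqnn /=; ring.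
    by rewrite leqNgt (_ : (m < i.-1)%N); [rewrite /=; ring | lia].
  - by rewrite (leq_pred m) ltn_eqF // -cosine_rec // /=; ring.
(* Adjacency is self-adjoint, so it moves from [phi] onto the eigenvector [f]. *)
have swap : \sum_y f y * (\sum_(z | adj y z) phi (d x z)) = theta * \sum_y phi (d x y) * f y.
  under eq_bigr do rewrite mulr_sumr.
  rewrite (exchange_big_dep predT) //= mulr_sumr; apply: eq_bigr => z _.
  rewrite -mulr_suml mulrCA -fE mulrC; congr (_ * _).
  by apply: eq_bigl => y; rewrite adj_sym.
have sumE : \sum_y phi (d x y) * f y = \sum_(y | (d x y <= m)%N) cosine (d x y) * f y.
  by rewrite [RHS]big_mkcond; apply: eq_bigr => y _; rewrite /phi; case: ifP; rewrite ?mul0r.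
rewrite mulrDl -sumE -swap.
under eq_bigr do rewrite nbr_sum phiE ?dist_leD //.
rewrite !mulr_sumr -big_split /= [X in _ = X - _]big_mkcond [X in _ = _ - X]big_mkcond -sumrB.
by apply: eq_bigr => y _; case: eqP; case: eqP => /= _ _; ring.
Qed.

(* Were [theta < - G D], the Christoffel-Darboux identity would propagate the positivity of
   [cosine m * s m] up to [m = D], where its right-hand side vanishes. *)
Lemma eigenvalue_ge theta (f : T -> R) x : f x = 1 ->
  (forall y, \sum_(z | adj y z) f z = theta * f y) -> - G D <= theta.
Proof.
move=> fx fE; rewrite leNgt; apply/negP => lt.
have {lt}neg : theta + G D < 0 by lra.
pose s m := \sum_(y | d x y == m) f y.
pose S m := \sum_(y | (d x y <= m)%N) cosine (d x y) * f y.
have CD m : (m <= D)%N ->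
    (theta + G D) * S m = C m.+1 * cosine m * s m.+1 - B m * cosine m.+1 * s m.
  by move=> mD; apply: christoffel_darboux.
have SS m : S m.+1 = S m + cosine m.+1 * s m.+1.
  rewrite /S /s mulr_sumr (bigID (fun y => d x y == m.+1)) /= addrC; congr (_ + _).
    by apply: eq_bigl => y; rewrite andbC -ltn_neqAle.
  apply: eq_big => [y|y /andP[_ /eqP->]//].
  by case: eqP => [->|]; rewrite ?leqnn ?andbF.
have pos m : (m <= D)%N -> 0 < cosine m * s m /\ 0 < S m.
  elim: m => [_|m IH mD].
    have x0 y : (d x y == 0%N) = (y == x) by rewrite dist_eq0 // eq_sym.
    rewrite /S /s; under eq_bigl do rewrite x0.
    under [X in _ /\ _ < X]eq_bigl do rewrite leqn0 x0.
    by rewrite !big_pred1_eq distxx fx !mul1r ltr01.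
  have [ws Sm] := IH (ltnW mD).
  suff ws1 : 0 < cosine m.+1 * s m.+1 by split=> //; rewrite SS; lra.
  have [Bm Cm] := bc_gt0 mD; have := CD _ (ltnW mD).
  have al := alpha_gt mD; have be := beta_gt mD.
  (* Consecutive cosines have ratio [- q] with [q] positive. The identity forces
     [cosine m * s m.+1 < 0], and the change of sign makes [cosine m.+1 * s m.+1] positive. *)
  pose q := (1 + alpha * G m) / (beta - alpha * G m).
  have q0 : 0 < q by rewrite divr_gt0.
  have -> : cosine m.+1 = - q * cosine m by rewrite /= /q; ring.
  have : 0 < B m * q * (cosine m * s m) by apply: (mulr_gt0 (mulr_gt0 Bm q0) ws).
  have : (theta + G D) * S m < 0 by rewrite nmulr_rlt0.
  move=> h1 h2 h3.
  have : C m.+1 * (cosine m * s m.+1) < 0 by lra.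
  rewrite pmulr_rlt0 // => h4.
  by rewrite mulNr mulNr -mulrA oppr_gt0 pmulr_rlt0.
have [_ SD] := pos _ (leqnn D).
have := CD _ (leqnn D); rewrite [B D]/b_class subrr !mul0r subr0.
have -> : s D.+1 = 0.
  by rewrite /s big_pred0 // => y; apply/negbTE; rewrite neq_ltn ltnS dist_leD.
by have : (theta + G D) * S D < 0; [rewrite nmulr_rlt0 | lra].
Qed.

Lemma smallest_eigenvalueE theta : smallest_eigenvalue adj theta -> theta = - G D.
Proof.
case=> ev /(_ _ eigenvalue_gaussN) le; apply/eqP; rewrite eq_le le /=.
have [f [x fx] fE] := (eigenvalue_adjP theta adj_sym).1 ev.
apply: (@eigenvalue_ge theta (fun y => f y / f x) x); first by rewrite divff.
by move=> y; rewrite -mulr_suml fE mulrA.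
Qed.

Lemma b_class0 : B 0 = G D * beta.
Proof. by rewrite /b_class gauss0 mulr0 !subr0. Qed.

(** * Incidence of points and lines *)

Section Lines.
Variable Cs : {set {set T}}.
Hypothesis hgeom : geometric adj (B 0) Cs.
Implicit Types L M : {set T}.

Local Notation lines x := [set L in Cs | x \in L].

Lemma gaussD_gt0 : 0 < G D.
Proof. by case: D D_gt0 => // n _; apply: gauss_gt0. Qed.

Lemma line_adj L u v : L \in Cs -> u \in L -> v \in L -> u != v -> adj u v.
Proof. by case: hgeom => h _ /h[+ _]; apply. Qed.

Lemma line_dist L u v w : L \in Cs -> u \in L -> v \in L -> (d w u <= (d w v).+1)%N.
Proof.
move=> LC uL vL; have [->|ne] := eqVneq u v; first exact: leqnSn.
by apply: dist_adj => //; apply: line_adj LC vL uL _; rewrite eq_sym.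
Qed.

Lemma card_line L : L \in Cs -> #|L|%:R = 1 + beta.
Proof.
case: hgeom => h _ /h[_ [theta [/smallest_eigenvalueE -> ->]]].
by rewrite b_class0 opprK mulrC mulrA mulVf ?mul1r // gt_eqF // gaussD_gt0.
Qed.

Lemma line_unique L M u v : L \in Cs -> M \in Cs -> u != v ->
  u \in L -> v \in L -> u \in M -> v \in M -> L = M.
Proof.
move=> LC MC ne uL vL uM vM.
have [_ /(_ u v (line_adj LC uL vL ne)) /eqP/cards1P[N NE]] := hgeom.
have eqN K : K \in Cs -> u \in K -> v \in K -> K = N.
  by move=> KC uK vK; apply/set1P; rewrite -NE inE KC uK vK.
by rewrite (eqN L) // (eqN M).
Qed.

(** Every edge at [x] lies in exactly one line, so the lines on [x], with [x] removed, partition its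
    neighbours. *)
Lemma sum_nbr_lines (g : T -> R) x :
  \sum_(L in lines x) \sum_(z in L | z != x) g z = \sum_(z | adj x z) g z.
Proof.
rewrite (exchange_big_dep (adj x)) /=; last first.
  move=> L z; rewrite inE => /andP[LC xL] /andP[zL zx].
  by apply: line_adj LC xL zL _; rewrite eq_sym.
apply: eq_bigr => z xz; case: hgeom => _ /(_ x z xz) card1.
rewrite -[RHS]mulr1n -card1 -sumr_const; apply: eq_bigl => L.
rewrite !inE; have [zx|_] := eqVneq z x; first by rewrite zx adj_irr in xz.
by rewrite andbT andbA.
Qed.

(** The [D] beta neighbours of [x] fall into groups of size beta, one for each line. *)
Lemma card_lines x : #|lines x|%:R = G D.
Proof.
have := sum_nbr_lines (fun=> 1) x; rewrite degreeE b_class0.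
rewrite (eq_bigr (fun=> beta)) => [|L].
  by rewrite sumr_const -[beta *+ _]mulr_natl; apply: mulIf; rewrite gt_eqF // beta_gt0.
rewrite inE => /andP[LC xL]; have := card_line LC.
by rewrite -sum1_card natr_sum (bigD1 x) //= => /addrI.
Qed.

(** With [N] the vertex-line incidence matrix and [A] the adjacency matrix, [N N^T = A + [D] I]
    kills [g]. Hence [g^T N N^T g], the sum of the squared line sums, is zero. *)
Lemma line_sum0 (g : T -> R) L :
  (forall y, \sum_(z | adj y z) g z = - G D * g y) -> L \in Cs -> \sum_(z in L) g z = 0.
Proof.
move=> gE LC; have sum0 y : \sum_(M in lines y) \sum_(z in M) g z = 0.
  transitivity (\sum_(M in lines y) (g y + \sum_(z in M | z != y) g z)).
    by apply: eq_bigr => M; rewrite inE => /andP[_ yM]; rewrite (bigD1 y).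
  by rewrite big_split /= sumr_const sum_nbr_lines gE -[g y *+ _]mulr_natl card_lines mulNr subrr.
suff /eqP : \sum_(M in Cs) (\sum_(z in M) g z) ^+ 2 = 0.
  rewrite psumr_eq0 => [/allP/(_ L)|M _]; last exact: sqr_ge0.
  by rewrite mem_index_enum LC sqrf_eq0 => /(_ isT)/eqP.
under eq_bigr do rewrite expr2 mulr_suml.
rewrite (exchange_big_dep predT) //= big1 // => y _.
rewrite -mulr_sumr -[RHS](mulr0 (g y)) -[in RHS](sum0 y); congr (_ * _).
by apply: eq_bigl => M; rewrite inE.
Qed.

(** Only the distances m and m+1 occur on [L], in numbers n and n' with n + n' = 1 + beta. The
    vanishing line sum n w_m + n' w_{m+1} = 0 then determines n. *)
Lemma card_line_dist x L m : L \in Cs -> (m < D)%N ->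
  (forall y, y \in L -> (m <= d x y)%N) -> (exists2 y, y \in L & d x y = m) ->
  #|[set y in L | d x y == m]|%:R = 1 + alpha * G m.
Proof.
move=> LC mD lb [y0 y0L dy0].
have := line_sum0 (cosine_eigen x) LC; have := card_line LC.
rewrite -sum1_card -sum1dep_card !natr_sum.
rewrite (bigID (fun y => d x y == m)) [X in _ -> X = _ -> _](bigID (fun y => d x y == m)) /=.
set n := \sum_(y in L | d x y == m) 1; set n' := \sum_(y in L | _) 1.
have -> : \sum_(y in L | d x y == m) cosine (d x y) = n * cosine m.
  by rewrite mulr_suml; apply: eq_bigr => y /andP[_ /eqP->]; rewrite mul1r.
have -> : \sum_(y in L | d x y != m) cosine (d x y) = n' * cosine m.+1.
  rewrite mulr_suml; apply: eq_bigr => y /andP[yL ne]; rewrite mul1r.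
  have := line_dist x LC yL y0L; have := lb _ yL; rewrite dy0 => le1 le2.
  by congr cosine; lia.
have be := beta_gt0; have w0 := cosine_neq0 (ltnW mD).
have e := cosineS mD => nE s0.
have n'E : n' = 1 + beta - n by rewrite -nE; ring.
(* After elimination of n' and w_{m+1}, the coefficient of n is w_m ((beta - alpha [m]) + (1 + alpha
   [m])), which is this nonzero factor. *)
apply: (mulfI (x := cosine m * (1 + beta))).
  by rewrite mulf_neq0 // gt_eqF //; lra.
apply/eqP; rewrite -subr_eq0 -[X in _ == X](mulr0 (beta - alpha * G m)) -s0; apply/eqP.
transitivity (n * cosine m * (beta - alpha * G m) + n' * (cosine m.+1 * (beta - alpha * G m))).
  by rewrite e n'E; ring.
by ring.
Qed.

(** * Brackets of vertices at distance two *)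

Hypothesis hD : (3 <= D)%N.

Lemma card_nbr_line y M : M \in Cs -> y \notin M -> [exists u in M, adj y u] ->
  #|[set u in M | adj y u]|%:R = 1 + alpha.
Proof.
move=> MC yM /exists_inP[u uM yu].
have d1 v : (d y v == 1%N) = adj y v by rewrite dist_eq1.
have := card_line_dist (x := y) (m := 1) MC (ltnW hD).
rewrite gauss1 // mulr1 => <-; last 2 first.
- by move=> v vM; rewrite lt0n dist_eq0 //; apply: contraNneq yM => ->.
- by exists u => //; apply/eqP; rewrite d1.
by congr (#|(_ : {set T})|%:R); apply/setP => v; rewrite !inE d1.
Qed.

Lemma dist2_adjF x y : d x y = 2 -> adj x y = false.
Proof. by move=> d2; rewrite -(dist_eq1 adj_sym adj_conn) // d2. Qed.

(** Without a neighbour of [y], the line [M] also cannot contain [y], so its distance from [y] is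
    exactly 2, attained at [x]; since 2 < D, [card_line_dist] applies. *)
Lemma line_far y x M : M \in Cs -> x \in M -> d x y = 2 -> ~~ [exists u in M, adj y u] ->
  #|[set v in M | d y v == 2]|%:R = 1 + alpha * G 2.
Proof.
move=> MC xM dxy; rewrite negb_exists_in => /forall_inP noadj.
apply: card_line_dist => //; last by exists x => //; rewrite dist_sym.
move=> v vM; rewrite ltnNge dist_le1 // negb_or noadj // andbT.
apply/eqP => yv; have := noadj x xM; rewrite yv.
have [vx|ne] := eqVneq v x; first by rewrite yv vx distxx in dxy.
by rewrite (line_adj MC vM xM ne).
Qed.

(** If a bracket line had no neighbour of [y], all its 1 + beta points would be at distance 2 from
    [y], whereas [line_far] allows only 1 + alpha [2], and beta > alpha [2]. *)
Lemma in_bracket x y M : d x y = 2 ->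
  (M \in bracket adj Cs x y) = [&& M \in Cs, x \in M & [exists u in M, adj y u]].
Proof.
move=> dxy; rewrite inE; case MC: (M \in Cs) => //=; case xM: (x \in M) => //=.
apply/idP/idP => [/forall_inP le2|/exists_inP[u uM yu]]; last first.
  apply/forall_inP => v vM; apply: leq_trans (line_dist y MC vM uM) _.
  by rewrite ltnS dist_le1 // yu orbT.
apply: contraT => far; have := line_far MC xM dxy far.
suff -> : [set v in M | d y v == 2] = M.
  by rewrite card_line // => /addrI e; have := beta_gt hD; rewrite e subrr ltxx.
apply/setP => v; rewrite inE; case vM: (v \in M) => //=.
rewrite eqn_leq le2 //= ltnNge dist_le1 // negb_or.
move: far; rewrite negb_exists_in => /forall_inP/(_ _ vM) ->; rewrite andbT.
apply/eqP => yv; have yx : y != x by apply: contra_eq_neq dxy => ->; rewrite distxx.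
by have := dist2_adjF dxy; rewrite adj_sym yv (line_adj MC vM xM) // -yv.
Qed.

(** The c_2 = (1 + b)(1 + alpha) common neighbours of [x] and [y] are sorted by the line joining
    them to [x]: each bracket line carries 1 + alpha of them, every other line none. *)
Lemma card_bracket x y : d x y = 2 -> #|bracket adj Cs x y|%:R = 1 + b%:~R :> R.
Proof.
move=> dxy; have dyx : d y x = 2 by rewrite dist_sym.
have al := alpha_gt (ltnW hD).
have := sum_pred y x; rewrite dyx /c_class gauss2 // addrC.
have adjE z : ((d y z).+1 == 2) = adj y z by rewrite eqSS dist_eq1.
under eq_bigr do rewrite adjE.
rewrite -sum_nbr_lines => e; apply: (mulIf (negbT (gt_eqF al))).
rewrite -e mulr_natl -sumr_const [LHS]big_mkcond [RHS]big_mkcond.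
apply: eq_bigr => M _; rewrite in_bracket // inE.
case MC: (M \in Cs) => //=; case xM: (x \in M) => //=.
symmetry; rewrite (bigID [pred z | adj y z]) /= [X in _ + X]big1 ?addr0; last first.
  by move=> z /andP[_ /negbTE->].
case: ifP => [ex|]; last first.
  move/negbT; rewrite negb_exists_in => /forall_inP no.
  by rewrite big1 // => z /andP[/andP[/no/negbTE->]].
have yM : y \notin M.
  apply/negP => yM; have := dist2_adjF dxy; rewrite (line_adj MC xM yM) //.
  by apply: contra_eq_neq dxy => ->; rewrite distxx.
rewrite gauss1 // mulr1 -(card_nbr_line MC yM ex) -sum1dep_card natr_sum.
apply: eq_big => [z|z /andP[_ ->]] //.
have [->|_] := eqVneq z x; last by rewrite andbT.
by rewrite adj_sym (dist2_adjF dxy) !andbF.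
Qed.

(** * Double counting between lines and brackets *)

Lemma card_linked L M : L \in Cs -> M \in Cs -> [disjoint L & M] ->
  #|[set y in L | [exists v in M, adj y v]]| = #|[set v in M | [exists y in L, adj v y]]|.
Proof.
(* Each point of [K] with a neighbour on [N] has exactly 1 + alpha of them, so the edges between the
   two lines can be counted from either side. *)
have sumE K N : K \in Cs -> N \in Cs -> [disjoint K & N] ->
    \sum_(y in K) \sum_(v in N) (adj y v)%:R =
    #|[set y in K | [exists v in N, adj y v]]|%:R * (1 + alpha).
  move=> KC NC dis; rewrite mulr_natl -sumr_const [RHS]big_mkcond [LHS]big_mkcond.
  apply: eq_bigr => y _; rewrite inE; case yK: (y \in K) => //=.
  case: ifP => [ex|]; last first.
    move/negbT; rewrite negb_exists_in => /forall_inP no.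
    by rewrite big1 // => v /no/negbTE->.
  rewrite -(card_nbr_line NC _ ex); last by rewrite (disjointFr dis).
  by rewrite -sum1dep_card natr_sum [RHS]big_mkcondr; apply: eq_bigr => v _; case: ifP.
move=> LC MC dis; have al := alpha_gt (ltnW hD); rewrite gauss1 // mulr1 in al.
apply/eqP; rewrite -(eqr_nat R); apply/eqP/(mulIf (negbT (gt_eqF al))).
rewrite -!sumE // 1?disjoint_sym // exchange_big /=.
by apply: eq_bigr => v _; apply: eq_bigr => y _; rewrite adj_sym.
Qed.

Lemma card_bracket_line x L M y2 : L \in Cs -> M \in Cs -> x \in M -> x \notin L ->
  [exists z in L, adj x z] -> (forall z, z \in L -> adj x z -> z \notin M) ->
  y2 \in L -> d x y2 = 2 -> M \notin bracket adj Cs x y2 ->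
  #|[set y in L | (d x y == 2) && (M \in bracket adj Cs x y)]|%:R <= alpha * b%:~R.
Proof.
move=> LC MC xM xL exZ avoid y2L d2; rewrite in_bracket // MC xM /= => far.
set N := (X in #|X|).
have dis : [disjoint L & M].
  apply/pred0P => v /=; apply/negbTE/negP => /andP[vL vM].
  have xv : x != v by apply: contraNneq xL => ->.
  by have := avoid v vL (line_adj MC xM vM xv); rewrite vM.
set Lst := [set y in L | [exists v in M, adj y v]].
set Mst := [set v in M | [exists y in L, adj v y]].
have cLM : #|Lst| = #|Mst| by apply: card_linked.
(* A point of [M] with a neighbour on [L] is within 2 of [y2] through [L]; it is no closer, as [M]
   contains neither [y2] nor a neighbour of it. *)
have subM : Mst \subset [set v in M | d y2 v == 2].
  apply/subsetP => v; rewrite !inE => /andP[vM /exists_inP[y yL vy]].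
  rewrite vM /= eqn_leq; apply/andP; split.
    have le1 : (d y2 y <= 1)%N by rewrite -(distxx adj y2); apply: line_dist LC yL y2L.
    by apply: (@leq_trans (d y2 y).+1) => //; apply: dist_adj; rewrite // adj_sym.
  rewrite ltnNge dist_le1 // negb_or; apply/andP; split.
    by apply/eqP => yv; move: (disjointFr dis y2L); rewrite yv vM.
  by move: far; rewrite negb_exists_in => /forall_inP/(_ v vM).
(* The 1 + alpha points of [Z] are linked to [M] by [x] itself but are not at distance 2 from [x].
   Removing them leaves at most (1 + alpha [2]) - (1 + alpha) = alpha b points for [N]. *)
set Z := [set z in L | adj x z].
have cZ : #|Z|%:R = 1 + alpha by apply: card_nbr_line.
have ZL : Z \subset Lst.
  apply/subsetP => z; rewrite !inE => /andP[-> xz]; apply/exists_inP.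
  by exists x => //; rewrite adj_sym.
have NL : N \subset Lst :\: Z.
  apply/subsetP => y; rewrite !inE => /andP[yL /andP[/eqP dy]].
  have := in_bracket M dy; rewrite inE => -> /and3P[_ _ ->].
  by rewrite yL (dist2_adjF dy).
have := subset_leq_card subM; have := subset_leq_card NL.
rewrite cardsDS // => le1 le2; have le3 := subset_leq_card ZL.
have : (#|Z| + #|N| <= #|[set v in M | d y2 v == 2]|)%N.
  by apply: leq_trans le2; rewrite -cLM -leq_subRL.
rewrite -(ler_nat R) natrD cZ (line_far MC xM d2 far) gauss2 //.
by lra.
Qed.

(** Distinct neighbours of [x] on [L] are joined to [x] by distinct lines: a line with two points on
    [L] equals [L], which misses [x]. *)
Lemma card_meeting_lines x L : L \in Cs -> x \notin L ->
  (#|[set z in L | adj x z]| <=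
   #|[set M in lines x | [exists z in L, adj x z && (z \in M)]]|)%N.
Proof.
move=> LC xL; set B0 := (X in (_ <= #|X|)%N).
have -> : #|[set z in L | adj x z]| = (\sum_(z | adj x z) (z \in L))%N.
  by rewrite -sum1dep_card big_mkcondl; apply: eq_bigr => z _; case: (z \in L).
have -> : #|B0| = (\sum_(M in lines x) (M \in B0))%N.
  rewrite -sum1_card big_mkcond [RHS]big_mkcond; apply: eq_bigr => M _.
  by rewrite [M \in B0]inE; case: (M \in lines x) => //=; case: ifP.
rewrite -(ler_nat R) !natr_sum -(sum_nbr_lines (fun z => (z \in L)%:R)).
apply: ler_sum => M Mx; rewrite [M \in B0]inE Mx /=.
have := Mx; rewrite inE => /andP[MC xM].
have xz z : z \in M -> z != x -> adj x z.
  by move=> zM zx; apply: line_adj MC xM zM _; rewrite eq_sym.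
case: (boolP [exists z in L, _]) => [/exists_inP[z zL /andP[az zM]]|]; last first.
  rewrite negb_exists_in => /forall_inP no.
  rewrite big1 // => z /andP[zM zx].
  by have := no z; rewrite zM xz //=; case: (z \in L) => // /(_ isT).
have zx : z != x by apply: contraTneq az => ->; rewrite adj_irr.
rewrite (bigD1 z) ?zM //= zL big1 ?addr0 // => u /andP[/andP[uM ux] uz].
case uL: (u \in L) => //; have LM := line_unique LC MC uz uL zL uM zM.
by move: xL; rewrite LM xM.
Qed.

Lemma bracket_sub x L y1 y2 :
  beta > (G D - alpha - 1) * alpha * b%:~R + alpha ->
  L \in Cs -> x \notin L -> [exists z in L, adj x z] ->
  y1 \in L -> y2 \in L -> d x y1 = 2 -> d x y2 = 2 ->
  bracket adj Cs x y1 \subset bracket adj Cs x y2.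
Proof.
move=> hbeta LC xL exZ y1L y2L d1 d2; apply: contraLR hbeta => /subsetPn[M0 M01 M02].
rewrite -leNgt.
set Z := [set z in L | adj x z]; set Y := [set y in L | d x y == 2].
set B0 := [set M in lines x | [exists z in L, adj x z && (z \in M)]].
(* [F] collects the lines common to all brackets; [P] keeps those that neither meet [L] in a
   neighbour of [x] nor lie in [F]. *)
pose F := [set M in lines x | [forall y in Y, M \in bracket adj Cs x y]].
pose P := lines x :\: (B0 :|: F).
have cZ : #|Z|%:R = 1 + alpha by apply: card_nbr_line.
(* 1 + alpha is the size of the nonempty set [Z], hence at least 1. The sign is needed to multiply
   the bound on [#|P|] by alpha b. *)
have alpha0 : 0 <= alpha.
  have : (0 < #|Z|)%N.
    by have /exists_inP[z zL xz] := exZ; apply/card_gt0P; exists z; rewrite inE zL.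
  by rewrite -(ler_nat R) cZ; lra.
have cY : #|Y|%:R = beta - alpha.
  have := card_line LC; rewrite -(cardsID Z) (_ : L :&: Z = Z); last first.
    by apply/setIidPr/subsetP => z; rewrite inE => /andP[].
  rewrite natrD cZ (_ : L :\: Z = Y); first by lra.
  apply/setP => y; rewrite !inE; case yL: (y \in L) => //=; rewrite ?andbF //.
  rewrite andbT; apply/idP/eqP => [nxy|/dist2_adjF->//].
  have /exists_inP[z zL xz] := exZ.
  have := line_dist x LC yL zL; have /eqP -> : d x z == 1 by rewrite dist_eq1.
  have : ~~ (d x y <= 1)%N.
    by rewrite dist_le1 // negb_or nxy andbT; apply: contraNneq xL => ->.
  by lia.
have B0F : B0 \subset F.
  apply/subsetP => M; rewrite !inE => /andP[/andP[MC xM] /exists_inP[z zL /andP[xz zM]]].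
  rewrite MC xM /=; apply/forall_inP => y; rewrite inE => /andP[yL /eqP dy].
  rewrite in_bracket // MC xM; apply/exists_inP; exists z => //.
  apply: line_adj LC yL zL _; apply/eqP => yz.
  by have := dist2_adjF dy; rewrite yz xz.
(* All brackets have size 1 + b, and [F] lies properly inside the first one because it omits [M0].
   So no bracket fits into [F]. *)
have cF y : y \in Y -> (#|F| < #|bracket adj Cs x y|)%N.
  rewrite inE => /andP[yL /eqP dy].
  have -> : #|bracket adj Cs x y| = #|bracket adj Cs x y1|.
    by apply/eqP; rewrite -(eqr_nat R) !card_bracket.
  apply/proper_card/properP; split; last first.
    exists M0 => //; rewrite inE negb_and negb_forall_in; apply/orP; right.
    by apply/exists_inP; exists y2; rewrite // inE y2L d2.
  by apply/subsetP => M; rewrite inE => /andP[_ /forall_inP]; apply; rewrite !inE y1L d1.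
have cover y : y \in Y -> exists2 M, M \in P & M \in bracket adj Cs x y.
  move=> yY; have : ~~ (bracket adj Cs x y \subset F).
    by apply/negP => /subset_leq_card; rewrite leqNgt cF.
  case/subsetPn => M My MF; exists M => //.
  rewrite inE (setUidPr B0F) MF.
  by move: My; rewrite !inE => /and3P[-> ->].
have cP : #|P|%:R <= G D - 1 - alpha.
  have sub : P \subset lines x :\: B0 by rewrite setDS // subsetUl.
  have B0x : B0 \subset lines x by apply/subsetP => M; rewrite [M \in B0]inE => /andP[].
  have := subset_leq_card sub; rewrite (cardsDS B0x) leq_subRL ?subset_leq_card // => le.
  have : (#|Z| + #|P| <= #|lines x|)%N.
    by apply: leq_trans le; rewrite leq_add2r; apply: card_meeting_lines.
  by rewrite -(ler_nat R) natrD cZ card_lines; lra.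
(* Pairs of a point [y] of [Y] and a line of [P] in its bracket are counted: each [y] has at least
   one such line, each line at most alpha b such points. *)
have : #|Y|%:R <= \sum_(M in P) (alpha * b%:~R).
  rewrite -sum1_card natr_sum.
  apply: (@le_trans _ _ (\sum_(y in Y) \sum_(M in P) (M \in bracket adj Cs x y)%:R)).
    apply: ler_sum => y /cover[M MP My].
    by rewrite (bigD1 M) //= My lerDl sumr_ge0.
  rewrite exchange_big /=; apply: ler_sum => M; rewrite !inE negb_or.
  move=> /andP[/andP[MB0 MF] /andP[MC xM]].
  move: MB0 MF; rewrite MC xM /= negb_exists_in negb_forall_in => /forall_inP avoid /exists_inP[y].
  rewrite inE => /andP[yL /eqP dy] My.
  have := card_bracket_line LC MC xM xL exZ _ yL dy My; rewrite -sum1dep_card natr_sum.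
  move=> h; apply: le_trans (h _); last first.
    by move=> z zL xz; have := avoid z zL; rewrite xz.
  rewrite [X in _ <= X](eq_bigl (fun y => (y \in Y) && (M \in bracket adj Cs x y))).
    by rewrite [X in _ <= X]big_mkcondr; apply: ler_sum => u _; case: (M \in _).
  by move=> u; rewrite [u \in Y]inE andbA.
rewrite cY sumr_const -[_ *+ _]mulr_natl => le.
have b2 := intr_ge2 R hb.
have ab : 0 <= alpha * b%:~R by rewrite mulr_ge0 //; lra.
have : #|P|%:R * (alpha * b%:~R) <= (G D - 1 - alpha) * (alpha * b%:~R) by apply: ler_wpM2r.
lra.
Qed.

End Lines.
End Drg.

Theorem theorem18 (T : finType) (adj : rel T) (R : rcfType)
    (D : nat) (b : int) (alpha beta : R) (Cs : {set {set T}})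
    (adj_sym : symmetric adj) (adj_irr : irreflexive adj)
    (adj_conn : forall x y, connect adj x y)
    (hclass : classical_DRG adj D b alpha beta)
    (hb : (2 <= b)%R) (hD : (3 <= D)%N)
    (hgeom : geometric adj (b_class D b alpha beta 0) Cs)
    (hbeta : (beta > (gauss R b D - alpha - 1) * alpha * b%:~R + alpha)%R) :
  forall (x : T) (L : {set T}), L \in Cs -> dist_set adj x L = 1%N ->
  forall y1 y2, y1 \in L -> y2 \in L ->
    dist adj x y1 = 2%N -> dist adj x y2 = 2%N ->
    bracket adj Cs x y1 = bracket adj Cs x y2.
Proof.
move=> x L LC dL y1 y2 y1L y2L d1 d2.
have D0 : (0 < D)%N by apply: leq_trans hD.
have xL : x \notin L.
  by apply/negP => /(dist_set_le adj x); rewrite dL distxx.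
have exZ : [exists z in L, adj x z].
  have [z zL dz] := dist_set_attained adj_conn x y1L.
  apply/exists_inP; exists z => //.
  by rewrite -(dist_eq1 adj_sym adj_conn) // dz dL.
have sub := bracket_sub adj_sym adj_irr adj_conn hclass hb D0 hgeom hD hbeta LC xL exZ.
by apply/eqP; rewrite eqEsubset !sub.
Qed.
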